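(* Every generalized Bratteli diagram is isomorphic to an irreducible generalized Bratteli diagram.
   Context: A generalized Bratteli diagram is a graded graph $B=(V,E)$ with $V=\bigsqcup_{n\ge 0}V_n$ and $E=\bigsqcup_{n\ge 0}E_n$ such that: (i) each level $V_n$ and each edge set $E_n$ is countably infinite; (ii) there are source and range maps $s,r$ on $E$ with $s(E_n)=V_n$ and $r(E_n)=V_{n+1}$ (so edges in $E_n$ go from $V_n$ to $V_{n+1}$, every vertex has at least one outgoing edge and every vertex outside $V_0$ has at least one incoming edge); (iii) $|r^{-1}(v)|<\infty$ for every $v\in V\setminus V_0$. Multiple edges are allowed. All levels $V_n$ are identified with one and the same countably infinite set (such as $\mathbb{N}$, $\mathbb{N}_0=\mathbb{N}\cup\{0\}$ or $\mathbb{Z}$); this enumeration is part of the data. A finite path from $w\in V_n$ to $v\in V_m$ ($m>n$) is a sequence of edges $(e_n,\dots,e_{m-1})$, $e_k\in E_k$, with $s(e_n)=w$, $s(e_k)=r(e_{k-1})$, $r(e_{m-1})=v$. $B$ is irreducible if, with all levels identified with the set $V_0$, for any $i,j\in V_0$ and any $n\in\mathbb{N}_0$ there exists $m>n$ such that there is a finite path from $i\in V_n$ to $j\in V_m$. Otherwise $B$ is reducible. (This depends on the identification of levels.) Two diagrams $B=(V,E)$ and $B'=(V',E')$ are isomorphic if there are bijections $g_n:V_n\to V_n'$ and $h_n:E_n\to E_n'$ for all $n\in\mathbb{N}_0$ with $s'\circ h_n=g_n\circ s$ and $r'\circ h_n=g_{n+1}\circ r$ on $E_n$. (The bijections $g_n$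 are not required to be compatible with the identifications of different levels.) *)

(* Defs.v *)
From mathcomp Require Import all_boot.
From mathcomp Require Import boolp classical_sets functions cardinality.

Set Implicit Arguments.
Unset Strict Implicit.
Unset Printing Implicit Defensive.

Local Open Scope classical_set_scope.
Local Open Scope card_scope.

(* The levels [vertex n] and [edge n] are the pieces of the disjoint unions
   V = \bigsqcup_n V_n and E = \bigsqcup_n E_n.  The identification of all
   levels with one common set is the family of bijections [label n] onto
   [index], which is therefore countably infinite as well. *)
Record generalized_bratteli_diagram := GeneralizedBratteliDiagram {
  vertex : nat -> Type;
  edge : nat -> Type;
  source : forall n, edge n -> vertex n;
  target : forall n, edge n -> vertex n.+1;
  vertex_countably_infinite : forall n, [set: vertex n] #= [set: nat];
  edge_countably_infinite : forall n, [set: edge n] #= [set: nat];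
  source_onto : forall n, range (@source n) = [set: vertex n];
  target_onto : forall n, range (@target n) = [set: vertex n.+1];
  target_fiber_finite : forall n (v : vertex n.+1),
    finite_set (@target n @^-1` [set v]);
  index : Type;
  label : forall n, vertex n -> index;
  label_bijective : forall n, bijective (@label n)
}.

Arguments source {_ n} _.
Arguments target {_ n} _.
Arguments label {_ n} _.

(* Nonempty edge sequences; an inhabitant of [finite_path w v] with
   [w : vertex B n] and [v : vertex B m] forces [n < m]. *)
Inductive finite_path (B : generalized_bratteli_diagram) (n : nat)
    (w : vertex B n) : forall m, vertex B m -> Type :=
| path_edge (e : edge B n) :
    source e = w -> finite_path w (target e)
| path_rcons m (v : vertex B m) (e : edge B m) :
    finite_path w v -> source e = v -> finite_path w (target e).

(* The copy of [i : vertex B 0] in level [n] is the vertex with the same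
   label. *)
Definition irreducible (B : generalized_bratteli_diagram) : Prop :=
  forall (i j : vertex B 0) (n : nat),
  exists (m : nat) (w : vertex B n) (v : vertex B m),
    [/\ n < m, label w = label i, label v = label j
      & inhabited (finite_path w v)].

Definition isomorphic (B B' : generalized_bratteli_diagram) : Prop :=
  exists (g : forall n, vertex B n -> vertex B' n)
         (h : forall n, edge B n -> edge B' n),
    [/\ forall n, bijective (g n),
        forall n, bijective (h n),
        forall n (e : edge B n), source (h n e) = g n (source e)
      & forall n (e : edge B n), target (h n e) = g n.+1 (target e)].

(* Main.v *)
(* Fix enumerations of the levels.  A requirement asks that a given vertex of
   level [n] have a descendant, at a later level, labelled [j].  Every vertex has
   descendants at all later levels, so encoding the requirements injectively as
   numbers [k >= n] and serving the one with code [k] at level [k.+1] constrains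
   each level by at most one prescribed label, which a transposition of the
   enumeration achieves. *)
From mathcomp Require Import all_boot.
From mathcomp Require Import boolp classical_sets functions cardinality.
Require Import Defs.

Set Implicit Arguments.
Unset Strict Implicit.
Unset Printing Implicit Defensive.

Local Open Scope classical_set_scope.
Local Open Scope card_scope.

(** Compose [b] with the transposition [t] of [b x] and [y]. *)
Lemma bijective_through (T : Type) (U : eqType) (b : T -> U) (x : T) (y : U) :
  bijective b -> exists2 f : T -> U, bijective f & f x = y.
Proof.
move=> bij_b; pose t z := if z == b x then y else if z == y then b x else z.
have tK : involutive t.
  rewrite /t => z; case: (eqVneq z (b x)) => [->|zx].
    by rewrite eqxx; case: eqP.
  case: (eqVneq z y) => [->|zy]; first by rewrite eqxx.
  by rewrite (negPf zx) (negPf zy).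
exists (t \o b); last by rewrite /= /t eqxx.
by apply: bij_comp bij_b; exists t.
Qed.

Lemma finite_path_exists (B : generalized_bratteli_diagram) n (w : vertex B n)
    m : n < m -> exists v : vertex B m, inhabited (finite_path w v).
Proof.
have out k (v : vertex B k) : exists e : edge B k, source e = v.
  by have [e _ <-] : range (@source B k) v; [rewrite source_onto | exists e].
elim: m => // m IHm; rewrite ltnS leq_eqVlt => /predU1P[nm | /IHm[v [p]]].
  case: m / nm {IHm}; have [e ew] := out n w.
  by exists (target e); split; apply: path_edge.
have [e ev] := out m v.
by exists (target e); split; apply: path_rcons p ev.
Qed.

Definition relabel (B : generalized_bratteli_diagram) (I : Type)
    (f : forall n, vertex B n -> I) (bij_f : forall n, bijective (@f n)) :
    generalized_bratteli_diagram :=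
  @GeneralizedBratteliDiagram (vertex B) (edge B) (@source B) (@target B)
    (@vertex_countably_infinite B) (@edge_countably_infinite B)
    (@source_onto B) (@target_onto B) (@target_fiber_finite B) I f bij_f.

(** Isomorphisms ignore [label], so identity maps suffice. *)
Lemma isomorphic_relabel (B : generalized_bratteli_diagram) (I : Type)
    (f : forall n, vertex B n -> I) (bij_f : forall n, bijective (@f n)) :
  isomorphic B (relabel bij_f).
Proof. by exists (fun _ => id), (fun _ => id); split=> // n; exists id. Qed.

Lemma universal_labelling (B : generalized_bratteli_diagram) :
  exists2 f : forall n, vertex B n -> nat, forall n, bijective (@f n) &
    forall n (w : vertex B n) (j : nat),
      exists m, n < m /\
        exists v : vertex B m, f m v = j /\ inhabited (finite_path w v).
Proof.
have /(_ _)/cid-/all_sig[b bij_b] n : exists b : vertex B n -> nat, bijective b.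
  have /card_set_bijP[b] := @vertex_countably_infinite B n.
  by rewrite setTT_bijective; exists b.
(* A sequence code exceeds each of its entries, so including [n] places the serving level after
   level [n]. *)
pose code n (w : vertex B n) j := CodeSeq.code [:: n; b n w; j].
have /(_ _)/cid-/all_sig[f fP] m : exists f : vertex B m -> nat, bijective f /\
    forall n (w : vertex B n) j, m = (code n w j).+1 ->
      exists v : vertex B m, f v = j /\ inhabited (finite_path w v).
  (* A level that serves no requirement keeps its enumeration [b m]. *)
  have [[n [w [j mE]]]|no_code] :=
    EM (exists n (w : vertex B n) j, m = (code n w j).+1); last first.
    exists (b m); split=> [|n w j mE]; first exact: bij_b.
    by case: no_code; exists n, w, j.
  have ltnm : n < m.
    by rewrite mE ltnS ltnW//; have /andP[] := CodeSeq.ltn_code [:: n; b n w; j].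
  have [v wv] := finite_path_exists w ltnm.
  have [f bij_f fv] := bijective_through v j (bij_b m).
  exists f; split=> // n' w' j'; rewrite [LHS]mE => -[].
  (* By injectivity of the code, any requirement served at level [m] is the chosen one. The levels
     are identified first, since the type of [w'] depends on [n']. *)
  move=> /(can_inj CodeSeq.codeK)[nn' + <-]; case: n' / nn' w' => w'.
  by move=> /(bij_inj (bij_b n)) <-; exists v.
exists f => [n|n w j]; first by have [] := fP n.
exists (code n w j).+1; split.
  by rewrite ltnS ltnW//; have /andP[] := CodeSeq.ltn_code [:: n; b n w; j].
by have [_] := fP (code n w j).+1; apply.
Qed.

Theorem theorem4p5 (B : generalized_bratteli_diagram) :
  exists B' : generalized_bratteli_diagram, irreducible B' /\ isomorphic B B'.
Proof.
have [f bij_f f_univ] := universal_labelling B.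
exists (relabel bij_f); split; last exact: isomorphic_relabel.
(* With [g] inverse to [f n], [g (f 0 i)] is the copy of [i] in level [n]. *)
move=> i j n; have [g _ gK] := bij_f n.
have [m [ltnm [v [fv [p]]]]] := f_univ n (g (f 0 i)) (f 0 j).
exists m, (g (f 0 i)), v; split=> //.
(* The type of paths depends on the whole diagram, labels included, so [p] is rebuilt edge by
   edge. *)
split; elim: p => {m ltnm v fv} [e ew | m v e _ p ev].
  exact: (@path_edge (relabel bij_f)).
exact: (@path_rcons (relabel bij_f) _ _ _ _ _ p ev).
Qed.
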